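(* ${}^*\mathbb{R}$ is a real-closed field.
   Context: $\mathbb{R}_+$ is the set of positive real numbers and $\mathbb{N}=\{1,2,3,\dots\}$. Fix an ultrafilter $\mathcal{U}$ on $\mathbb{R}_+$ such that $(0,\tfrac1n)\in\mathcal{U}$ for all $n\in\mathbb{N}$. A property of $\varepsilon\in\mathbb{R}_+$ holds almost everywhere (a.e.) if the set of $\varepsilon$ for which it holds belongs to $\mathcal{U}$. For nets $(a_\varepsilon),(b_\varepsilon)\in\mathbb{C}^{\mathbb{R}_+}$ write $(a_\varepsilon)\sim(b_\varepsilon)$ if $a_\varepsilon=b_\varepsilon$ a.e.; $\langle a_\varepsilon\rangle$ is the equivalence class of $(a_\varepsilon)$, and ${}^*\mathbb{C}=\mathbb{C}^{\mathbb{R}_+}/\!\sim$ is the field of such classes, with operations induced pointwise. ${}^*\mathbb{R}=\{\langle a_\varepsilon\rangle\in{}^*\mathbb{C} : a_\varepsilon\in\mathbb{R}\text{ a.e.}\}$. A field $\mathbb{K}$ is called real closed if (a) for all $a\in\mathbb{K}$ either $x^2=a$ or $x^2=-a$ is solvable in $\mathbb{K}$, and (b) every polynomial of odd degree with coefficients in $\mathbb{K}$ has a root in $\mathbb{K}$. *)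

(* Defs.v *)
From HB Require Import structures.
From mathcomp Require Import all_boot all_order all_algebra.
From mathcomp Require Import generic_quotient interval_inference complex.
From mathcomp Require Import boolp classical_sets functions filter reals.

Set Implicit Arguments.
Unset Strict Implicit.
Unset Printing Implicit Defensive.

Import Order.TTheory GRing.Theory Num.Theory.
Local Open Scope classical_set_scope.
Local Open Scope quotient_scope.
Local Open Scope ring_scope.

Section NetEquivalence.
Variables (R : realType) (U : set_system {posnum R}) (FU : UltraFilter U).

Definition net : Type := {posnum R} -> R[i].

(* [FU] is a phantom argument here; carrying it lets the instances below,
   which need that [U] is an ultrafilter, be found from the type alone. *)
Definition ae_eq of UltraFilter U : rel net :=
  fun a b => `[< U [set e | a e = b e] >].

Lemma ae_eq_refl : reflexive (ae_eq FU).
Proof. by move=> a; apply/asboolP; apply: filterS filterT. Qed.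

Lemma ae_eq_sym : symmetric (ae_eq FU).
Proof.
by move=> a b; apply/asboolP/asboolP; apply: filterS => e /= ->.
Qed.

Lemma ae_eq_trans : transitive (ae_eq FU).
Proof.
move=> b a c /asboolP ab /asboolP bc; apply/asboolP.
by apply: filterS2 ab bc => e /= -> ->.
Qed.

Canonical ae_eq_equiv := EquivRel (ae_eq FU) ae_eq_refl ae_eq_sym ae_eq_trans.

Definition starC : Type := {eq_quot ae_eq FU}.

HB.instance Definition _ := Choice.on starC.
HB.instance Definition _ := EqQuotient.on starC.

Definition cls (a : net) : starC := \pi_starC a.

Lemma clsP (a b : net) : cls a = cls b <-> U [set e | a e = b e].
Proof.
by split=> [/eqmodP/asboolP|ab]; last by apply/eqmodP/asboolP.
Qed.

Lemma cls_repr (x : starC) : cls (repr x) = x.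
Proof. exact: reprK. Qed.

Lemma repr_cls (a : net) : U [set e | repr (cls a) e = a e].
Proof. by apply/clsP; rewrite cls_repr. Qed.

Lemma cls_ind (P : starC -> Prop) : (forall a, P (cls a)) -> forall x, P x.
Proof. by move=> Pcls x; rewrite -(cls_repr x). Qed.

Definition starC_add (x y : starC) : starC :=
  cls (fun e => repr x e + repr y e).
Definition starC_opp (x : starC) : starC := cls (fun e => - repr x e).
Definition starC_mul (x y : starC) : starC :=
  cls (fun e => repr x e * repr y e).
Definition starC_inv (x : starC) : starC := cls (fun e => (repr x e)^-1).

Lemma starC_addE a b : starC_add (cls a) (cls b) = cls (fun e => a e + b e).
Proof.
by apply/clsP; apply: filterS2 (repr_cls a) (repr_cls b) => e /= -> ->.
Qed.

Lemma starC_oppE a : starC_opp (cls a) = cls (fun e => - a e).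
Proof. by apply/clsP; apply: filterS (repr_cls a) => e /= ->. Qed.

Lemma starC_mulE a b : starC_mul (cls a) (cls b) = cls (fun e => a e * b e).
Proof.
by apply/clsP; apply: filterS2 (repr_cls a) (repr_cls b) => e /= -> ->.
Qed.

Lemma starC_invE a : starC_inv (cls a) = cls (fun e => (a e)^-1).
Proof. by apply/clsP; apply: filterS (repr_cls a) => e /= ->. Qed.

Lemma starC_addA : associative starC_add.
Proof.
elim/cls_ind=> a; elim/cls_ind=> b; elim/cls_ind=> c; rewrite !starC_addE.
by congr cls; apply/funext => e; rewrite addrA.
Qed.

Lemma starC_addC : commutative starC_add.
Proof.
elim/cls_ind=> a; elim/cls_ind=> b; rewrite !starC_addE.
by congr cls; apply/funext => e; rewrite addrC.
Qed.

Lemma starC_add0 : left_id (cls (fun=> 0)) starC_add.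
Proof.
elim/cls_ind=> a; rewrite starC_addE.
by congr cls; apply/funext => e; rewrite add0r.
Qed.

Lemma starC_addN : left_inverse (cls (fun=> 0)) starC_opp starC_add.
Proof.
elim/cls_ind=> a; rewrite starC_oppE starC_addE.
by congr cls; apply/funext => e; rewrite addNr.
Qed.

HB.instance Definition _ :=
  GRing.isZmodule.Build starC starC_addA starC_addC starC_add0 starC_addN.

Lemma starC_mulA : associative starC_mul.
Proof.
elim/cls_ind=> a; elim/cls_ind=> b; elim/cls_ind=> c; rewrite !starC_mulE.
by congr cls; apply/funext => e; rewrite mulrA.
Qed.

Lemma starC_mulC : commutative starC_mul.
Proof.
elim/cls_ind=> a; elim/cls_ind=> b; rewrite !starC_mulE.
by congr cls; apply/funext => e; rewrite mulrC.
Qed.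

Lemma starC_mul1 : left_id (cls (fun=> 1)) starC_mul.
Proof.
elim/cls_ind=> a; rewrite starC_mulE.
by congr cls; apply/funext => e; rewrite mul1r.
Qed.

Lemma starC_mulDl : left_distributive starC_mul starC_add.
Proof.
elim/cls_ind=> a; elim/cls_ind=> b; elim/cls_ind=> c.
rewrite !(starC_addE, starC_mulE).
by congr cls; apply/funext => e; rewrite mulrDl.
Qed.

Lemma starC_1_neq0 : cls (fun=> 1) != cls (fun=> 0).
Proof.
apply/eqP => /clsP U10; apply: (@filter_not_empty _ U).
by apply: filterS U10 => e /= /eqP; rewrite oner_eq0.
Qed.

HB.instance Definition _ := GRing.Zmodule_isComNzRing.Build starC
  starC_mulA starC_mulC starC_mul1 starC_mulDl starC_1_neq0.

Lemma starC_mulV (x : starC) : x != 0 -> starC_inv x * x = 1.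
Proof.
elim/cls_ind: x => a /eqP a0; rewrite starC_invE.
rewrite [LHS]starC_mulE; apply/clsP.
have [Ua|Ua] := in_ultra_setVsetC [set e | a e = 0] FU.
  by case: a0; apply/clsP.
by apply: filterS Ua => e /= /eqP ae0; rewrite mulVf.
Qed.

Lemma starC_inv0 : starC_inv 0 = 0.
Proof.
by rewrite [LHS]starC_invE; congr cls; apply/funext => e; rewrite invr0.
Qed.

HB.instance Definition _ :=
  GRing.ComNzRing_isField.Build starC starC_mulV starC_inv0.

Lemma clsD a b : cls a + cls b = cls (fun e => a e + b e).
Proof. exact: starC_addE. Qed.

Lemma clsN a : - cls a = cls (fun e => - a e).
Proof. exact: starC_oppE. Qed.

Lemma clsM a b : cls a * cls b = cls (fun e => a e * b e).
Proof. exact: starC_mulE. Qed.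

Lemma clsV a : (cls a)^-1 = cls (fun e => (a e)^-1).
Proof. exact: starC_invE. Qed.

Lemma cls0 : cls (fun=> 0) = 0. Proof. by []. Qed.

Lemma cls1 : cls (fun=> 1) = 1. Proof. by []. Qed.

(* On [R[i]], [Num.real] holds exactly of the numbers with imaginary part 0. *)
Definition is_starR : {pred starC} := fun x =>
  `[< exists2 a : net, x = cls a & U [set e | a e \is Num.real] >].

Lemma is_starR_divring : divring_closed is_starR.
Proof.
split=> [|x y /asboolP[a -> Ua] /asboolP[b -> Ub]
         |x y /asboolP[a -> Ua] /asboolP[b -> Ub]]; apply/asboolP.
- exists (fun=> 1); first by rewrite cls1.
  by apply: filterS filterT => e _ /=; exact: rpred1.
- exists (fun e => a e - b e); first by rewrite clsN clsD.
  by apply: filterS2 Ua Ub => e /=; exact: rpredB.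
- exists (fun e => a e / b e); first by rewrite clsV clsM.
  by apply: filterS2 Ua Ub => e /=; exact: rpred_div.
Qed.

HB.instance Definition _ :=
  GRing.isDivringClosed.Build starC is_starR is_starR_divring.

Record starR : Type := StarR {
  starR_val : starC;
  starR_valP : starR_val \in is_starR
}.

HB.instance Definition _ := [isSub for starR_val].
HB.instance Definition _ := [Choice of starR by <:].
HB.instance Definition _ := [SubChoice_isSubComUnitRing of starR by <:].
HB.instance Definition _ := [SubComUnitRing_isSubIntegralDomain of starR by <:].
HB.instance Definition _ := [SubIntegralDomain_isSubField of starR by <:].

End NetEquivalence.

(* No order is part of this notion. In the second clause the zero polynomial,
   of size 0, is excluded since [odd 0.-1] is false. *)
Definition real_closed (K : fieldType) : Prop :=
  (forall a : K, (exists x : K, x ^+ 2 = a) \/ (exists x : K, x ^+ 2 = - a)) /\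
  (forall p : {poly K}, odd (size p).-1 -> exists x : K, root p x).

(* Main.v *)
Require Import Defs.
From mathcomp Require Import all_boot all_order all_algebra.
From mathcomp Require Import interval_inference complex polyrcf.
From mathcomp Require Import boolp classical_sets functions filter reals.

Import Order.TTheory GRing.Theory Num.Theory.
Local Open Scope classical_set_scope.
Local Open Scope ring_scope.

(* Transfer: both clauses hold in R for almost every e, and choosing a square
   root or a polynomial root for each such e yields a net whose class is a
   solution in *R.  The ultrafilter decides the sign of a net of reals. *)

Section RealNets.
Variables (R : realType) (U : set_system {posnum R}) (FU : UltraFilter U).
Implicit Types (a b : {posnum R} -> R).

Lemma cls_real_subproof a : cls FU (fun e => (a e)%:C%C) \in is_starR (FU := FU).
Proof.
apply/asboolP; exists (fun e => (a e)%:C%C) => //.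
by apply: filterS filterT => e _ /=; apply/complex_realP; exists (a e).
Qed.

(** Representing elements by nets valued in [R] rather than [R[i]] gives direct access to the order,
    square roots and root theorem of [R]. *)
Definition rcls a : starR FU := StarR (cls_real_subproof a).

Lemma rclsP a b : rcls a = rcls b <-> U [set e | a e = b e].
Proof.
split=> [[/clsP]|ab].
  by apply: filterS => e /= /complexI.
by apply/val_inj/clsP; apply: filterS ab => e /= ->.
Qed.

(** Taking real parts changes a representing net only where its value is not real, and that set is
    negligible. *)
Lemma rcls_surj (x : starR FU) : exists a, x = rcls a.
Proof.
have /asboolP[a xa Ua] := starR_valP x.
exists (fun e => complex.Re (a e)); apply/val_inj; rewrite /= xa; apply/clsP.
by apply: filterS Ua => e /= /complex_realP[k ->].
Qed.

Lemma rcls0 : rcls (fun=> 0) = 0.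
Proof. exact/val_inj. Qed.

Lemma rcls1 : rcls (fun=> 1) = 1.
Proof. exact/val_inj. Qed.

Lemma rclsD a b : rcls a + rcls b = rcls (fun e => a e + b e).
Proof.
apply/val_inj; rewrite rmorphD /= clsD; congr (cls _ _).
by apply/funext => e; rewrite rmorphD.
Qed.

Lemma rclsN a : - rcls a = rcls (fun e => - a e).
Proof.
apply/val_inj; rewrite rmorphN /= clsN; congr (cls _ _).
by apply/funext => e; rewrite rmorphN.
Qed.

Lemma rclsM a b : rcls a * rcls b = rcls (fun e => a e * b e).
Proof.
apply/val_inj; rewrite rmorphM /= clsM; congr (cls _ _).
by apply/funext => e; rewrite rmorphM.
Qed.

Lemma rclsX a n : rcls a ^+ n = rcls (fun e => a e ^+ n).
Proof.
elim: n => [|n IHn]; first by rewrite expr0 -rcls1.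
rewrite exprS IHn rclsM; congr rcls.
by apply/funext => e; rewrite exprS.
Qed.

Lemma rcls_sum n (c : nat -> {posnum R} -> R) :
  \sum_(i < n) rcls (c i) = rcls (fun e => \sum_(i < n) c i e).
Proof.
elim: n => [|n IHn].
  by rewrite big_ord0 -rcls0; congr rcls; apply/funext => e; rewrite big_ord0.
rewrite big_ord_recr /= IHn rclsD; congr rcls.
by apply/funext => e; rewrite big_ord_recr.
Qed.

(** Evaluation is a sum of products whose number of terms, [size p], does not depend on [e], so it
    commutes with passing to classes. At a given [e] the polynomial on the right may have smaller
    degree than [p]. *)
Lemma horner_rcls (p : {poly starR FU}) (c : nat -> {posnum R} -> R) a :
  (forall i, p`_i = rcls (c i)) ->
  p.[rcls a] = rcls (fun e => (\poly_(i < size p) c i e).[a e]).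
Proof.
move=> pc; rewrite horner_coef.
under eq_bigr do rewrite pc rclsX rclsM.
rewrite (rcls_sum _ (fun i e => c i e * a e ^+ i)); congr rcls.
by apply/funext => e; rewrite horner_poly.
Qed.

Lemma starR_sqrt (x : starR FU) :
  (exists y, y ^+ 2 = x) \/ (exists y, y ^+ 2 = - x).
Proof.
have [a ->] := rcls_surj x.
have [Ua|Ua] := in_ultra_setVsetC [set e | 0 <= a e] FU; [left|right].
  (* [Num.sqrt] is total, so this is a net on all indices; its square needs to be [a e] only on the
     set [Ua]. *)
  exists (rcls (fun e => Num.sqrt (a e))); rewrite rclsX; apply/rclsP.
  by apply: filterS Ua => e /= /sqr_sqrtr.
exists (rcls (fun e => Num.sqrt (- a e))); rewrite rclsX rclsN; apply/rclsP.
apply: filterS Ua => e /= /negP; rewrite -ltNge => ae0.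
by rewrite sqr_sqrtr // oppr_ge0 ltW.
Qed.

Lemma starR_odd_root (p : {poly starR FU}) :
  odd (size p).-1 -> exists x, root p x.
Proof.
move=> podd; have sp : size p = (size p).-1.+1 by case: (size p) podd.
have [c pc] := choice (fun i => rcls_surj p`_i).
pose q e := \poly_(i < size p) c i e.
(* Otherwise the leading coefficient of [p] would be the class of a net vanishing a.e. Hence [q e]
   has the same odd degree as [p] for almost every [e]. *)
have Uq : U [set e | c (size p).-1 e != 0].
  have [U0|] := in_ultra_setVsetC [set e | c (size p).-1 e = 0] FU.
    have : lead_coef p = 0 by rewrite lead_coefE pc -rcls0; apply/rclsP.
    by move/eqP; rewrite lead_coef_eq0 -size_poly_eq0 sp.
  by apply: filterS => e /= /eqP.
(* The implication makes the choice total: where the top coefficient vanishes, [q e] may have no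
   root and the value 0 is taken. *)
have [e|r qr] := choice (_ : forall e, exists y : R,
    c (size p).-1 e != 0 -> root (q e) y).
  have [c0|_] := boolP (c (size p).-1 e != 0); last by exists 0.
  have [|y qy] := @odd_poly_root _ (q e); last by exists y.
  (* [odd_poly_root] asks for an even size, which is the successor of the odd degree; hence the
     double negation. *)
  by rewrite sp in c0 *; rewrite /q sp size_poly_eq //= negbK.
exists (rcls r); rewrite rootE (horner_rcls _ _ _ pc) -rcls0.
by apply/eqP/rclsP; apply: filterS Uq => e /= /qr/rootP.
Qed.

End RealNets.

Theorem corollary2p4p5 (R : realType) (U : set_system {posnum R})
    (FU : UltraFilter U)
    (U_small : forall n : nat, (0 < n)%N -> U [set e | e%:num < n%:R^-1]) :
  real_closed (starR FU).
Proof. by split; [exact: starR_sqrt | exact: starR_odd_root]. Qed.
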